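(* Let $V$ be a locally linearly compact vector space over a discrete field $\mathbb K$ and let $\phi\colon V\to V$ be a continuous endomorphism. If $\alpha\colon V\to W$ is a topological isomorphism of locally linearly compact vector spaces, then $\mathrm{ent}(\phi)=\mathrm{ent}(\alpha\phi\alpha^{-1})$.
   Context: $\mathbb K$ is an arbitrary field endowed with the discrete topology. A topological vector space over $\mathbb K$ is linearly topologized if it is Hausdorff and has a neighborhood basis at $0$ consisting of linear subspaces. A linear variety of $V$ is a coset $v+W$ of a linear subspace $W$; it is closed (open) if $W$ is closed (open). A linearly topologized vector space is linearly compact if every collection of closed linear varieties with the finite intersection property has non-empty intersection. A linearly topologized vector space is locally linearly compact (l.l.c.) if it has an open linear subspace that is linearly compact; $\mathcal B(V)$ denotes the family of all linearly compact open linear subspaces of $V$. ''Endomorphism'' means linear endomorphism; a topological isomorphism is a linear isomorphism that is a homeomorphism. For a continuous endomorphism $\phi$ of an l.l.c. space $V$, $U\in\mathcal B(V)$ and a positive integer $n$, let $T_n(\phi,U)=U+\phi U+\dots+\phi^{n-1}U$. Define $H(\phi,U)=\lim_{n\to\infty}\frac1n\dim\frac{T_n(\phi,U)}{U}$ (the limit exists) and $\mathrm{ent}(\phi)=\sup\{H(\phi,U)\mid U\in\mathcal B(V)\}\in\mathbb N\cup\{\infty\}$. *)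

(* Defs.v *)
From HB Require Import structures.
From mathcomp Require Import all_boot all_order all_algebra.
From mathcomp Require Import generic_quotient ring_quotient.
From mathcomp Require Import boolp classical_sets functions filter reals.
From mathcomp Require Import constructive_ereal topology ereal.

Set Implicit Arguments.
Unset Strict Implicit.
Unset Printing Implicit Defensive.

Import GRing.Theory.
Local Open Scope classical_set_scope.
Local Open Scope ring_scope.

(* Topological vector spaces over an arbitrary field with the discrete topology.
   The topologicalLmodType of MathComp-Analysis needs a numDomainType of scalars
   with its norm topology. Continuity of the opposite is that of scaling by -1.
   The file tvs of MathComp-Analysis must not be loaded before this structure:
   its join NbhsLmodule, over a numDomainType, makes HB reject the join of
   Topological and Lmodule over a general field. *)
HB.mixin Record isDiscreteTvs (K : fieldType) V
    & Topological V & GRing.Lmodule K V := {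
  dadd_continuous : continuous (fun z : V * V => z.1 + z.2);
  dscale_continuous :
    continuous (fun z : discrete_topology K * V => (z.1 : K) *: z.2)
}.

#[short(type="discreteTvsType")]
HB.structure Definition DiscreteTvs (K : fieldType) :=
  {V of Topological V & GRing.Lmodule K V & isDiscreteTvs K V}.

(* Linear subspaces are GRing's submodClosed predicates. Over a ring of scalars
   these are closed under opposites, but the library makes them an instance of
   zmodClosed, which Quotient.quot requires, only at construction time; hence
   the alias subspace_pred. *)
Section QuotientSpace.
Variables (K : fieldType) (V : lmodType K) (U : submodClosed V).

Definition subspace_pred : {pred V} := [in U].

Lemma subspace_pred_closed : zmod_closed subspace_pred.
Proof.
split; first exact: (rpred0 U).
move=> u v Uu Uv; apply: (rpredD (S := U)) => //.
by rewrite -scaleN1r; apply: rpredZ.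
Qed.

HB.instance Definition _ :=
  GRing.isZmodClosed.Build V subspace_pred subspace_pred_closed.

Local Notation Q0 :=
  (Quotient.quot (GRing.ZmodClosed.clone V subspace_pred _)).

Definition quotient_space : Type := Q0.

HB.instance Definition _ := GRing.Zmodule.on quotient_space.

Definition quotient_proj (v : V) : quotient_space :=
  (\pi_Q0 v)%qT.

Definition quotient_scale (a : K) (q : quotient_space) : quotient_space :=
  quotient_proj (a *: repr (q : Q0)).

Lemma quotient_projP v w : quotient_proj v = quotient_proj w <-> v - w \in U.
Proof.
have e := @Quotient.idealrBE V (GRing.ZmodClosed.clone V subspace_pred _) v w.
rewrite -[v - w \in U]/(v - w \in subspace_pred) e.
by split=> /eqP.
Qed.

Lemma quotient_projD v w :
  quotient_proj (v + w) = quotient_proj v + quotient_proj w.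
Proof. exact: (raddfD (\pi_Q0)%qT). Qed.

Lemma quotient_projZ a v :
  quotient_proj (a *: v) = quotient_scale a (quotient_proj v).
Proof.
apply/quotient_projP; rewrite -scalerBr rpredZ//.
by apply/quotient_projP; rewrite /quotient_proj reprK.
Qed.

Lemma quotient_proj_surj (q : quotient_space) : exists v, q = quotient_proj v.
Proof. by exists (repr (q : Q0)); rewrite /quotient_proj reprK. Qed.

Lemma quotient_scaleA a b q :
  quotient_scale a (quotient_scale b q) = quotient_scale (a * b) q.
Proof.
by have [v ->] := quotient_proj_surj q; rewrite -!quotient_projZ scalerA.
Qed.

Lemma quotient_scale1 : left_id 1 quotient_scale.
Proof.
by move=> q; have [v ->] := quotient_proj_surj q;
  rewrite -quotient_projZ scale1r.
Qed.

Lemma quotient_scaleDr : right_distributive quotient_scale +%R.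
Proof.
move=> a p q; have [v ->] := quotient_proj_surj p.
have [w ->] := quotient_proj_surj q.
by rewrite -quotient_projD -!quotient_projZ -quotient_projD scalerDr.
Qed.

Lemma quotient_scaleDl q : {morph quotient_scale^~ q : a b / a + b}.
Proof.
move=> a b; have [v ->] := quotient_proj_surj q.
by rewrite -!quotient_projZ -quotient_projD scalerDl.
Qed.

HB.instance Definition _ := GRing.Zmodule_isLmodule.Build K quotient_space
  quotient_scaleA quotient_scale1 quotient_scaleDr quotient_scaleDl.

Lemma quotient_proj_is_linear : linear quotient_proj.
Proof. by move=> a v w; rewrite quotient_projD quotient_projZ. Qed.

HB.instance Definition _ := GRing.isLinear.Build K V quotient_space _
  quotient_proj quotient_proj_is_linear.

End QuotientSpace.

Section Dimension.
Variables (R : realType) (K : fieldType) (V : lmodType K).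

Definition is_basis (S : set V) (n : nat) (b : 'I_n -> V) : Prop :=
  (forall c : 'I_n -> K, \sum_(i < n) c i *: b i = 0 -> forall i, c i = 0) /\
  S = [set \sum_(i < n) c i *: b i | c in [set: 'I_n -> K]].

(* All infinite dimensions are collapsed to +oo. *)
Definition dimension (S : set V) : \bar R :=
  xget +oo%E [set (n%:R)%:E | n in
    [set n | exists b : 'I_n -> V, is_basis S b]].

End Dimension.

Section LinearTopology.
Variables (K : fieldType) (V : discreteTvsType K).

Definition linearly_topologized : Prop :=
  hausdorff_space V /\
  forall A : set V, nbhs 0 A ->
    exists2 U : submodClosed V, nbhs 0 [set` U] & [set` U] `<=` A.

Definition linear_variety (A : set V) : Prop :=
  exists v : V, exists W : submodClosed V, A = [set v + w | w in [set` W]].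

(* For the topology induced by V on U. *)
Definition linearly_compact (U : submodClosed V) : Prop :=
  forall C : set (set V),
    (forall A, C A -> [/\ A `<=` [set` U], linear_variety A &
                          closed (A : set (subspace [set` U]))]) ->
    finI C id -> \bigcap_(A in C) A !=set0.

(* Denoted B(V) in the literature. *)
Definition lc_open_subspaces : set (submodClosed V) :=
  [set U : submodClosed V | open [set` U] /\ linearly_compact U].

Definition locally_linearly_compact : Prop :=
  linearly_topologized /\ lc_open_subspaces !=set0.

End LinearTopology.

Arguments linearly_topologized {K} V.
Arguments locally_linearly_compact {K} V.
Arguments lc_open_subspaces {K} V.

Section Entropy.
Variables (R : realType) (K : fieldType) (V : discreteTvsType K).
Variable phi : {linear V -> V}.

(* U + phi U + ... + phi^(n-1) U *)
Definition trajectory (n : nat) (U : submodClosed V) : set V :=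
  [set \sum_(i < n) iter i phi (u i) |
    u in [set u : 'I_n -> V | forall i, u i \in U]].

(* H(phi, U), where (U + ... + phi^(n-1) U) / U is the image of the trajectory
   in the quotient of V by U. The sequence is indexed from n = 1. *)
Definition entropy_wrt (U : submodClosed V) : \bar R :=
  limn (fun n : nat =>
    ((n.+1%:R^-1)%:E *
     dimension R (@quotient_proj K V U @` trajectory n.+1 U))%E).

Definition ent : \bar R :=
  ereal_sup [set entropy_wrt U | U in lc_open_subspaces V].

End Entropy.

Record topIso (K : fieldType) (V W : discreteTvsType K) := TopIso {
  iso_fun :> {linear V -> W};
  iso_inv : W -> V;
  iso_funK : cancel iso_fun iso_inv;
  iso_invK : cancel iso_inv iso_fun;
  iso_continuous : continuous iso_fun;
  iso_inv_continuous : continuous iso_inv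
}.

HB.instance Definition _ (K : fieldType) (V W : discreteTvsType K)
    (f : topIso V W) :=
  GRing.isLinear.Build K W V _ (iso_inv f)
    (can2_linear (iso_funK f) (iso_invK f)).

(* Main.v *)
(* For U in B(W) the preimage U0 of U under alpha lies in B(V), and alpha
   induces an injection V/U0 -> W/U that carries T_n(phi, U0)/U0 onto
   T_n(psi, U)/U whenever alpha phi = psi alpha. Hence H(phi, U0) = H(psi, U)
   and ent psi <= ent phi; the converse is the same inequality for the inverse
   of alpha. *)
From HB Require Import structures.
Require Import Defs.
From mathcomp Require Import all_boot all_order all_algebra.
From mathcomp Require Import finmap boolp classical_sets functions filter reals.
From mathcomp Require Import constructive_ereal topology ereal.
Import GRing.Theory Order.TTheory.

Local Open Scope classical_set_scope.
Local Open Scope ring_scope.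

Section Preimage.
Context {K : fieldType} {V W : lmodType K} (f : {linear V -> W}).
Variable U : submodClosed W.

Definition preim_subspace_pred : {pred V} := [pred v | f v \in U].

Lemma preim_subspace_closed : submod_closed preim_subspace_pred.
Proof.
split=> [|a u v]; rewrite !inE ?linear0 ?rpred0// => fu fv.
by rewrite linearP rpredD ?rpredZ.
Qed.

HB.instance Definition _ :=
  GRing.isSubmodClosed.Build K V preim_subspace_pred preim_subspace_closed.

Definition preim_subspace : submodClosed V :=
  GRing.SubmodClosed.clone K V preim_subspace_pred _.

Lemma mem_preim_subspace v : (v \in preim_subspace) = (f v \in U).
Proof. by []. Qed.

(** The value is taken at the representative chosen by [repr]. Two representatives differ by a
    vector that [f] sends into [U], so the choice is immaterial; this is [quotient_map_proj]. *)
Definition quotient_map (q : quotient_space preim_subspace) :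
    quotient_space U :=
  quotient_proj U (f (repr q)).

Lemma quotient_map_proj v :
  quotient_map (quotient_proj preim_subspace v) = quotient_proj U (f v).
Proof.
apply/quotient_projP; rewrite -linearB -mem_preim_subspace.
by apply/quotient_projP; rewrite /quotient_proj reprK.
Qed.

Lemma quotient_map_is_linear : linear quotient_map.
Proof.
move=> a p q; have [v ->] := quotient_proj_surj p.
have [w ->] := quotient_proj_surj q.
by rewrite -linearP !quotient_map_proj !linearP.
Qed.

HB.instance Definition _ := GRing.isLinear.Build K _ _ _
  quotient_map quotient_map_is_linear.

(** The kernel is trivial because the quotient is by the full preimage of [U]. *)
Lemma quotient_map_inj : injective quotient_map.
Proof.
move=> p q; have [v ->] := quotient_proj_surj p.
have [w ->] := quotient_proj_surj q.
rewrite !quotient_map_proj => /quotient_projP; rewrite -linearB => vw.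
exact/quotient_projP.
Qed.

End Preimage.

Lemma is_basis_image {K : fieldType} {V W : lmodType K} (f : {linear V -> W})
    (S : set V) n (b : 'I_n -> V) :
  injective f -> is_basis S b -> is_basis (f @` S) (f \o b).
Proof.
move=> f_inj [b_free ->].
have fsum c : f (\sum_(i < n) c i *: b i) = \sum_(i < n) c i *: (f \o b) i.
  by rewrite linear_sum; apply: eq_bigr => i _; rewrite linearZ.
split=> [c|].
  by rewrite -fsum -(linear0 f) => /f_inj; exact: b_free.
rewrite image_comp; apply: eq_imagel => c _; exact: fsum.
Qed.

Lemma is_basis_preimage {K : fieldType} {V W : lmodType K} (f : {linear V -> W})
    (S : set V) n (b : 'I_n -> W) :
  injective f -> is_basis (f @` S) b -> exists b', is_basis S (n := n) b'.
Proof.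
move=> f_inj [b_free fS].
have /choice[b' fb'] i : exists v, f v = b i.
  have: (f @` S) (b i).
    (* Kronecker coefficients exhibit [b i] as a combination of the basis, hence as a point of the
       image of [S], which can be lifted. *)
    rewrite fS; exists (fun j => (j == i)%:R) => //.
    rewrite (bigD1 i)//= eqxx scale1r big1 ?addr0// => j /negPf ->.
    by rewrite scale0r.
  by case=> v _ <-; exists v.
have fsum c : f (\sum_(i < n) c i *: b' i) = \sum_(i < n) c i *: b i.
  by rewrite linear_sum; apply: eq_bigr => i _; rewrite linearZ /= fb'.
exists b'; split=> [c c0|].
  by apply: b_free; rewrite -fsum c0 linear0.
apply/seteqP; split=> [v Sv|_ [c _ <-]].
  have: (f @` S) (f v) by exists v.
  rewrite fS => -[c _ fv]; exists c => //; apply: f_inj.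
  by rewrite fsum.
have: (f @` S) (\sum_(i < n) c i *: b i) by rewrite fS; exists c.
by case=> v Sv; rewrite -fsum => /f_inj <-.
Qed.

(** Bases transfer both ways, so the same lengths [n] are admissible for both sets. If there is
    none, both sides take the default [+oo]. *)
Lemma dimension_image (R : realType) {K : fieldType} {V W : lmodType K}
    (f : {linear V -> W}) (S : set V) :
  injective f -> dimension R (f @` S) = dimension R S.
Proof.
move=> f_inj; rewrite /dimension; congr (xget _ (_ @` _)).
apply/seteqP; split=> n [b bS].
  exact: is_basis_preimage bS.
exists (f \o b); exact: is_basis_image.
Qed.

Section TopIso.
Context {K : fieldType} {V W : discreteTvsType K} (alpha : topIso V W).

Definition topIso_sym : topIso W V :=
  @TopIso K W V (iso_inv alpha) alpha (iso_invK alpha) (iso_funK alpha)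
    (@iso_inv_continuous _ _ _ alpha) (@iso_continuous _ _ _ alpha).

Lemma linear_variety_preim_inv (A : set V) :
  linear_variety A -> linear_variety (iso_inv alpha @^-1` A).
Proof.
move=> [v [U ->]]; exists (alpha v), (preim_subspace (iso_inv alpha) U).
apply/seteqP; split=> [w [u Uu vu]|_ [w Uw <-]].
  exists (alpha u); first by rewrite /= mem_preim_subspace/= iso_funK.
  by rewrite -linearD vu iso_invK.
by exists (iso_inv alpha w) => //; rewrite /preimage/= linearD /= iso_funK.
Qed.

(** The family [C] is carried to [W] by [alpha], each image being written as a preimage under
    [iso_inv alpha]. A common point [w] there gives the common point [iso_inv alpha w] of [C]. *)
Lemma linearly_compact_preim (U : submodClosed W) :
  linearly_compact U -> linearly_compact (preim_subspace alpha U).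
Proof.
move=> Ucompact C CU Cfin.
pose D := [set iso_inv alpha @^-1` A | A in C].
have [||w Dw] := Ucompact D.
- move=> _ [A /CU[AU Avar Aclosed] <-]; split.
  + by move=> w /AU /=; rewrite mem_preim_subspace/= iso_invK.
  + exact: linear_variety_preim_inv.
  (* Relative closedness means having the same trace on the subspace as a closed set [F] of [V]; the
     trace identity is pulled back along the continuous inverse. *)
  + have /closed_subspaceP[F Fclosed FA] := Aclosed.
    apply/closed_subspaceP; exists (iso_inv alpha @^-1` F).
      by apply: (preimage_closed _ Fclosed) => w _; exact: iso_inv_continuous.
    have -> : [set` U] = iso_inv alpha @^-1` [set` preim_subspace alpha U].
      apply/seteqP; split=> w; rewrite /preimage/= mem_preim_subspace/=;
      by rewrite iso_invK.
    by rewrite -!preimage_setI FA.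
- move=> E ED.
  (* Pulling a finite subfamily of [D] back along [alpha] undoes the transport and gives a finite
     subfamily of [C]. *)
  pose E' := [fset alpha @^-1` B | B in E]%fset.
  have E'C A : A \in E' -> A \in C.
    move=> /imfsetP[B /= /ED /set_mem[A0 CA0 <-] ->].
    rewrite -comp_preimage (_ : _ \o _ = id) ?preimage_id ?inE//.
    by apply: funext => v /=; rewrite iso_funK.
  have [v Ev] := Cfin _ E'C; exists (alpha v) => B BE.
  by apply: (Ev (alpha @^-1` B)); apply/imfsetP; exists B.
exists (iso_inv alpha w) => A CA; apply: (Dw (iso_inv alpha @^-1` A)).
by exists A.
Qed.

Lemma lc_open_preim (U : submodClosed W) :
  lc_open_subspaces W U -> lc_open_subspaces V (preim_subspace alpha U).
Proof.
move=> [Uopen Ucompact]; split; last exact: linearly_compact_preim.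
by apply: open_comp Uopen => v _; exact: iso_continuous.
Qed.

Section Conjugation.
Variables (phi : {linear V -> V}) (psi : {linear W -> W}).
Hypothesis semiconj : forall v, alpha (phi v) = psi (alpha v).

(** Semiconjugacy moves [alpha] past each iterate of [phi]. Surjectivity of [alpha] gives equality:
    a family in [U] lifts through [iso_inv alpha]. *)
Lemma trajectory_preim n (U : submodClosed W) :
  alpha @` trajectory phi n (preim_subspace alpha U) = trajectory psi n U.
Proof.
have alpha_sum (u : 'I_n -> V) : alpha (\sum_(i < n) iter i phi (u i)) =
    \sum_(i < n) iter i psi (alpha (u i)).
  rewrite linear_sum; apply: eq_bigr => i _.
  by elim: (val i) => //= k <-; rewrite semiconj.
apply/seteqP; split=> [_ [_ [u Uu <-] <-]|_ [u Uu <-]].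
  by exists (alpha \o u) => //; rewrite alpha_sum.
exists (\sum_(i < n) iter i phi (iso_inv alpha (u i))).
  by exists (iso_inv alpha \o u) => // i; rewrite mem_preim_subspace/= iso_invK.
by rewrite alpha_sum; apply: eq_bigr => i _; rewrite iso_invK.
Qed.

Lemma entropy_wrt_preim (R : realType) (U : submodClosed W) :
  entropy_wrt R phi (preim_subspace alpha U) = entropy_wrt R psi U.
Proof.
rewrite /entropy_wrt; congr (limn _); apply: funext => n; congr (_ * _)%E.
rewrite -trajectory_preim -(dimension_image R _ _ (quotient_map_inj alpha U)).
congr (dimension R _); rewrite !image_comp; apply: eq_imagel => v _ /=.
exact: quotient_map_proj.
Qed.

Lemma ent_semiconj_le (R : realType) : (ent R psi <= ent R phi)%E.
Proof.
apply: le_ereal_sup => _ [U Uopen <-]; exists (preim_subspace alpha U).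
  exact: lc_open_preim.
exact: entropy_wrt_preim.
Qed.

End Conjugation.
End TopIso.

Theorem proposition4p1 (R : realType) (K : fieldType)
    (V W : discreteTvsType K)
    (hV : locally_linearly_compact V) (hW : locally_linearly_compact W)
    (phi : {linear V -> V}) (hphi : continuous phi)
    (alpha : topIso V W) :
  ent R phi = ent R (alpha \o phi \o iso_inv alpha).
Proof.
apply/eqP; rewrite eq_le; apply/andP; split.
  (* For the inverse isomorphism the two endomorphisms exchange roles, so the conjugate of [phi] now
     bounds [phi]. *)
  apply: (ent_semiconj_le (topIso_sym alpha)) => w /=.
  by rewrite iso_funK.
by apply: (ent_semiconj_le alpha) => v /=; rewrite iso_funK.
Qed.
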